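(* Let $u \in C^2(\mathbb{R}^n)$ be a convex function satisfying $\det D^2 u = 0$ in $\mathbb{R}^n$ and $$\lim_{x\to\infty} \Delta u(x) = 0.$$ Then $u$ is an affine function.
   Context: $D^2u$ denotes the Hessian matrix of $u$ and $\Delta u$ its trace. The limit $x\to\infty$ means $\|x\|\to\infty$ in $\mathbb{R}^n$. *)

(* Defs.v *)
From mathcomp Require Import all_boot all_order all_algebra.
From mathcomp Require Import all_classical all_reals all_analysis.
Import Order.TTheory GRing.Theory Num.Theory.
Import numFieldNormedType.Exports.

Set Implicit Arguments.
Unset Strict Implicit.
Unset Printing Implicit Defensive.

Local Open Scope classical_set_scope.
Local Open Scope ring_scope.

Section Defs.
Variables (R : realType) (n : nat).

Definition partial (i : 'I_n) (u : 'rV[R]_n -> R) : 'rV[R]_n -> R :=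
  fun x => 'D_(delta_mx 0 i) u x.

(* [derivable] is required separately: ['D_v u x] is a total [lim], which has
   a junk value where the directional derivative does not exist. *)
Fixpoint class_C (k : nat) (u : 'rV[R]_n -> R) : Prop :=
  continuous u /\
  if k is k'.+1 then
    forall i : 'I_n,
      (forall x, derivable u x (delta_mx 0 i)) /\ class_C k' (partial i u)
  else True.

Definition hessian (u : 'rV[R]_n -> R) (x : 'rV[R]_n) : 'M[R]_n :=
  \matrix_(i, j) partial i (partial j u) x.

Definition laplacian (u : 'rV[R]_n -> R) (x : 'rV[R]_n) : R :=
  \tr (hessian u x).

(* The library norm [`|x|] on ['rV[R]_n] is the sup norm. *)
Definition euclidean_norm (x : 'rV[R]_n) : R :=
  Num.sqrt (\sum_(i < n) x 0 i ^+ 2).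

Definition at_infinity : set_system 'rV[R]_n :=
  filter_from [set: R] (fun M => [set x | M < euclidean_norm x]).

Definition affine_function (u : 'rV[R]_n -> R) : Prop :=
  exists (a : 'rV[R]_n) (b : R), forall x, u x = \sum_(i < n) a 0 i * x 0 i + b.

End Defs.

(* Main.v *)
Require Import Defs.
From mathcomp Require Import all_boot all_order all_algebra.
From mathcomp Require Import all_classical all_reals all_analysis.
From mathcomp Require Import ring lra.
Import Order.TTheory GRing.Theory Num.Theory.
Import numFieldNormedType.Exports.
Local Open Scope classical_set_scope.
Local Open Scope ring_scope.

(* If, for some linear form p, u - p exceeded u 0 on a whole sphere, then
   u - p - e |x|^2 would have an interior local minimum for small e > 0, and
   D^2 u would be positive definite there.  Hence, by compactness, every p
   admits a ray from the origin along which u - p stays below u 0.  Taking p to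
   be an average of finitely many gradients Du(x_i), the gradient inequality
   forces Du(x_i).v to be the same for all i, where v is the direction of the
   ray; choosing the x_i so that the gradient differences span a space of maximal
   dimension makes Du.v constant.  So D^2 u is invariant along v, the decay of
   the Laplacian at infinity makes it vanish identically, and a convex function
   with zero Laplacian is affine. *)

Set Implicit Arguments.
Unset Strict Implicit.
Unset Printing Implicit Defensive.

(** * The Euclidean inner product on row vectors *)

Section Dot.
Variables (R : realType) (n : nat).
Implicit Types (a b x y : 'rV[R]_n) (c : R).

Definition dot a x : R := \sum_(i < n) a 0 i * x 0 i.

Lemma dotC a x : dot a x = dot x a.
Proof. by apply: eq_bigr => i _; rewrite mulrC. Qed.

Lemma dotDr a x y : dot a (x + y) = dot a x + dot a y.
Proof.
by rewrite /dot -big_split /=; apply: eq_bigr => i _; rewrite mxE mulrDr.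
Qed.

Lemma dotZr a c x : dot a (c *: x) = c * dot a x.
Proof. by rewrite /dot mulr_sumr; apply: eq_bigr => i _; rewrite mxE mulrCA. Qed.

Lemma dotNr a x : dot a (- x) = - dot a x.
Proof. by rewrite -scaleN1r dotZr mulN1r. Qed.

Lemma dotBr a x y : dot a (x - y) = dot a x - dot a y.
Proof. by rewrite dotDr dotNr. Qed.

Lemma dot0r a : dot a 0 = 0.
Proof. by rewrite -(scale0r 0) dotZr mul0r. Qed.

Lemma dotDl a b x : dot (a + b) x = dot a x + dot b x.
Proof. by rewrite dotC dotDr !(dotC x). Qed.

Lemma dotZl c a x : dot (c *: a) x = c * dot a x.
Proof. by rewrite dotC dotZr dotC. Qed.

Lemma dotBl a b x : dot (a - b) x = dot a x - dot b x.
Proof. by rewrite dotC dotBr !(dotC x). Qed.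

Lemma dot_suml (I : Type) (r : seq I) (F : I -> 'rV[R]_n) x :
  dot (\sum_(i <- r) F i) x = \sum_(i <- r) dot (F i) x.
Proof.
by elim: r => [|i r IH]; rewrite ?big_nil ?big_cons ?dotDl ?IH// dotC dot0r.
Qed.

Lemma dot_delta a i : dot a (delta_mx 0 i) = a 0 i.
Proof.
rewrite /dot (bigD1 i)//= mxE !eqxx mulr1 big1 ?addr0// => j ji.
by rewrite mxE (negbTE ji) andbF mulr0.
Qed.

Lemma dotxx_ge0 x : 0 <= dot x x.
Proof. by apply: sumr_ge0 => i _; rewrite -expr2 sqr_ge0. Qed.

Lemma dotxx_gt0 x : x != 0 -> 0 < dot x x.
Proof.
move=> x0; rewrite lt_def dotxx_ge0 andbT.
apply: contraNneq x0 => /eqP; rewrite psumr_eq0; last first.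
  by move=> i _; rewrite -expr2 sqr_ge0.
move=> /allP xi0; apply/eqP/rowP => i; rewrite mxE.
by have := xi0 i (mem_index_enum _); rewrite -expr2 sqrf_eq0 => /eqP.
Qed.

Lemma norm_coord_le x i : `|x 0 i| <= `|x|.
Proof.
rewrite [leRHS]/Num.Def.normr/= mx_normrE.
by apply/bigmax_geP; right => /=; exists (0, i).
Qed.

(** The norm on the right is the sup norm, whence the factor [n%:R]. *)
Lemma dotxx_le_norm x : dot x x <= n%:R * `|x| ^+ 2.
Proof.
rewrite -[n in n%:R]card_ord mulr_natl -sumr_const; apply: ler_sum => i _.
by rewrite -expr2 -real_normK ?num_real// ler_sqr ?nnegrE// norm_coord_le.
Qed.

Lemma dot_continuous a : continuous (dot a).
Proof.
apply: (@continuous_big _ _ +%R 0 xpredT) => [|i _ x]; first exact: add_continuous.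
by apply: continuousM; [exact: cst_continuous|exact: coord_continuous].
Qed.

End Dot.

(** * Restriction to lines and the mean value theorem *)

Section Line.
Variables (R : realType) (V : normedModType R).

Lemma is_derive_line (f : V -> R) (x v : V) (t d : R) :
  is_derive (x + t *: v) v f d ->
  is_derive t (1 : R) (fun s : R => f (x + s *: v)) d.
Proof.
move=> fd.
have e : (fun h : R =>
      h^-1 *: (((fun s => f (x + s *: v)) \o shift t) (h *: (1 : R)) - f (x + t *: v))) =
    (fun h : R => h^-1 *: ((f \o shift (x + t *: v)) (h *: v) - f (x + t *: v))).
  apply/funext => h; rewrite /= [h *: 1]mulr1 scalerDl.
  by congr (_ *: (f _ - _)); rewrite addrCA.
constructor.
  by rewrite /derivable e; exact: ex_derive.
by rewrite /derive e; exact: derive_val.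
Qed.

Lemma derivable_line_continuous (f : V -> R) (x v : V) (t : R) :
  derivable f (x + t *: v) v -> {for t, continuous (fun s : R => f (x + s *: v))}.
Proof.
move=> /derivableP/is_derive_line fd.
exact/differentiable_continuous/derivable1_diffP.
Qed.

(** Since [c] may have either sign, [t] is only located by its absolute value. *)
Lemma mvt_line (f : V -> R) (x v : V) (c : R) :
  (forall t, derivable f (x + t *: v) v) ->
  exists2 t, `|t| <= `|c| & f (x + c *: v) - f x = c * 'D_v f (x + t *: v).
Proof.
move=> fv.
have fd s : is_derive s (1 : R) (fun s : R => f (x + s *: v)) ('D_v f (x + s *: v)).
  exact/is_derive_line/derivableP.
have fc (A : set R) : {within A, continuous (fun s : R => f (x + s *: v))}.
  by apply: continuous_subspaceT => s; exact: derivable_line_continuous.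
have [c0|c0] := leP 0 c.
  have [t] := MVT_segment c0 (fun s _ => fd s) (fc _).
  rewrite in_itv/= => /andP[t0 tc]; rewrite scale0r addr0 subr0 mulrC => e.
  by exists t => //; rewrite !ger0_norm.
have [t] := MVT_segment (ltW c0) (fun s _ => fd s) (fc _).
rewrite in_itv/= => /andP[tc t0]; rewrite scale0r addr0 sub0r mulrN => e.
exists t; first by rewrite !ler0_norm ?lerN2// ltW.
by rewrite -opprB e mulrC opprK.
Qed.

End Line.

(** * Continuous partial derivatives give all directional derivatives *)

Section Gradient.
Variables (R : realType) (n : nat).
Implicit Types (f u : 'rV[R]_n -> R) (x v : 'rV[R]_n).

Definition grad f x : 'rV[R]_n := \row_i partial i f x.

Lemma is_derive_grad f x v : class_C 1 f -> is_derive x v f (dot (grad f x) v).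
Proof.
move=> [fc fC].
(* Moving from x to x + h v one coordinate at a time reduces the claim to the
   mean value theorem for the partial derivatives. *)
pose T k : 'rV[R]_n := \row_(i < n) (if (i < k)%N then v 0 i else 0).
have Tn : T n = v by apply/rowP => i; rewrite mxE ltn_ord.
have T0 : T 0%N = 0 by apply/rowP => i; rewrite !mxE.
have TS k (kn : (k < n)%N) :
    T k.+1 = T k + v 0 (Ordinal kn) *: delta_mx 0 (Ordinal kn).
  apply/rowP => i; rewrite !mxE ltnS leq_eqVlt eqxx /=.
  have [-> /=|ik] := eqVneq i (Ordinal kn); first by rewrite eqxx ltnn mulr1 add0r.
  by rewrite -(inj_eq val_inj) /= in ik; rewrite (negbTE ik) /= mulr0 addr0.
have Tv k : `|T k| <= `|v|.
  rewrite [leLHS]/Num.Def.normr/= mx_normrE; apply/bigmax_leP; split => //= -[i j] _.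
  rewrite /= ord1 mxE; case: ifP => _; first exact: norm_coord_le.
  by rewrite normr0.
(* Each coordinate move adds an error of at most [e] times the size of [h] times the norm of [v], so
   [k] moves add [k] such terms. *)
have main (e : R) : 0 < e -> \forall h \near (0 : R), forall k, (k <= n)%N ->
    `|f (x + h *: T k) - f x - h * dot (grad f x) (T k)| <= `|h| * (k%:R * (`|v| * e)).
  move=> e0.
  have : \forall y \near x, forall i : 'I_n, `|partial i f x - partial i f y| <= e.
    apply: (@filter_forall _ _ (fun i y => `|partial i f x - partial i f y| <= e)
      _ (nbhs_filter x)) => i.
    by have [_ [pc _]] := fC i; move/cvgrPdist_le: (pc x) => /(_ e e0).
  move=> /nbhs_normP[d /= d0 xd].
  (* The factor 2 covers the two displacements from [x] to the mean value point: [h *: T k] and the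
     partial move along coordinate [k]. *)
  have : \forall h \near (0 : R), `|h| * (2 * `|v|) < d.
    have : `|h| * (2 * `|v|) @[h --> (0 : R)] --> `|0 : R| * (2 * `|v|).
      by apply: cvgMr_tmp; apply: cvg_norm.
    rewrite normr0 mul0r => /cvgr_lt; exact.
  apply: filterS => h hd; elim=> [|k IH] kn.
    by rewrite T0 scaler0 addr0 subrr dot0r mulr0 subrr normr0 mul0r mulr0.
  rewrite (TS _ kn); set i := Ordinal kn.
  have [|t tc ft] := @mvt_line _ _ f (x + h *: T k) (delta_mx 0 i) (h * v 0 i).
    by move=> t; have [+ _] := fC i; exact.
  rewrite scalerDr scalerA addrA dotDr dotZr dot_delta mxE.
  have := IH (ltnW kn); set A := f (x + h *: T k) => IHk.
  set B := f _ in ft *.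
  have {ft} -> : B = A + h * v 0 i * partial i f (x + h *: T k + t *: delta_mx 0 i).
    by rewrite /partial -ft /A addrC subrK.
  set y := x + h *: T k + t *: delta_mx 0 i.
  have yd : `|x - y| < d.
    apply: le_lt_trans hd; rewrite /y opprD addrA opprD addrA subrr add0r -opprD normrN.
    apply: (le_trans (ler_normD _ _)); rewrite !normrZ mulr_natl mulr2n mulrDr lerD//.
      by rewrite ler_wpM2l.
    rewrite (@le_trans _ _ `|t|)//; last first.
      by rewrite (le_trans tc)// normrM ler_wpM2l// norm_coord_le.
    rewrite -[leRHS]mulr1 ler_wpM2l//.
    rewrite [leLHS]/Num.Def.normr/= mx_normrE; apply/bigmax_leP; split => //= -[i' j] _.
    by rewrite /= mxE; case: (_ && _); rewrite ?normr1 ?normr0.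
  have /(_ i) := xd _ yd => pe.
  have -> : A + h * v 0 i * partial i f y - f x -
      h * (dot (grad f x) (T k) + v 0 i * partial i f x) =
     (A - f x - h * dot (grad f x) (T k)) - h * (v 0 i * (partial i f x - partial i f y)).
    by ring.
  apply: (le_trans (ler_normB _ _)).
  rewrite -natr1 mulrDl mul1r mulrDr lerD// !normrM ler_wpM2l// ler_pM//.
  exact: norm_coord_le.
have q : h^-1 *: ((f \o shift x) (h *: v) - f x) @[h --> 0^'] --> dot (grad f x) v.
  apply/cvgrPdist_le => e e0.
  have b0 : 0 <= n%:R * `|v| by rewrite mulr_ge0.
  (* Adding 1 keeps the denominator positive even when [v] is zero. *)
  have e'0 : 0 < e / (n%:R * `|v| + 1) by rewrite divr_gt0// ltr_wpDl.
  rewrite near_withinE; apply: filterS (main _ e'0) => h hh h0.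
  have := hh n (leqnn n); rewrite Tn /= => hn.
  rewrite -[dot _ _](mulKf h0) -mulrBr.
  rewrite normrM normfV ler_pdivrMl ?normr_gt0// distrC addrC.
  apply: (le_trans _ (le_trans hn _)); last first.
    rewrite ler_wpM2l// !mulrA [_ * e]mulrC -mulrA ler_piMr// ?(ltW e0)//.
    by rewrite ler_pdivrMr ?mul1r ?lerDl// ltr_wpDl.
  by rewrite [h *: v + x]addrC addrC.
apply: DeriveDef; last exact: cvg_lim q.
by apply/cvg_ex; exists (dot (grad f x) v).
Qed.

End Gradient.

(** * Bounds on derivatives from one-sided difference quotients *)

Section Onesided.
Variables (R : realType) (V : normedModType R).
Implicit Types (f : V -> R) (x v : V) (c d : R).

Lemma is_derive_cvg_right f x v d : is_derive x v f d ->
  h^-1 * (f (x + h *: v) - f x) @[h --> 0^'+] --> d.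
Proof.
move=> fd; have : h^-1 *: ((f \o shift x) (h *: v) - f x) @[h --> 0^'] --> d.
  by rewrite -(@derive_val _ _ _ _ _ _ _ fd); exact: ex_derive.
move=> q A /q /nbhs_ballP[e /= e0 eA].
exists e => //= h eh h0; rewrite (addrC x); apply: (eA h eh).
by rewrite gt_eqF.
Qed.

Lemma is_derive_ge f x v c d : is_derive x v f d ->
  (forall h, 0 < h -> h * c <= f (x + h *: v) - f x) -> c <= d.
Proof.
move=> /is_derive_cvg_right fd fc; apply: (cvgr_to_ge fd).
apply: filterS (nbhs_right_gt 0) => h h0.
by rewrite ler_pdivlMl// fc.
Qed.

(** The restriction [h <= 1] suits convexity, which bounds [f] from above only between the endpoints
    of a segment. *)
Lemma is_derive_le f x v c d : is_derive x v f d ->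
  (forall h, 0 < h -> h <= 1 -> f (x + h *: v) - f x <= h * c) -> d <= c.
Proof.
move=> /is_derive_cvg_right fd fc; apply: (cvgr_to_le fd).
apply: filterS2 (nbhs_right_gt 0) (nbhs_right_le ltr01) => h h0 h1.
by rewrite ler_pdivrMl// fc.
Qed.

End Onesided.

(** * Gradient inequality and subgradients of a convex function *)

Section Convex.
Variables (R : realType) (n : nat) (u : 'rV[R]_n -> R).
Hypothesis ucvx : convex_function [set: convex_lmodType 'rV[R]_n] u.
Hypothesis uC1 : class_C 1 u.

Lemma convex_function_le (x y : 'rV[R]_n) (h : R) : 0 <= h -> h <= 1 ->
  u (x + h *: (y - x)) <= u x + h * (u y - u x).
Proof.
move=> h0 h1.
have := ucvx (Itv01 h0 h1) (in_setT (y : convex_lmodType 'rV[R]_n)) (in_setT x).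
rewrite /conv/= /GRing.scale/=.
rewrite (_ : u (x + h *: (y - x)) = u (h *: y + (1 - h) *: x)); last first.
  by congr u; rewrite scalerBr scalerBl scale1r addrC -addrA [- _ + x]addrC.
move=> /le_trans; apply.
rewrite [conv _ _ _](_ : _ = h * u y + (1 - h) * u x)// le_eqVlt.
by apply/orP; left; apply/eqP; ring.
Qed.

Lemma grad_le (x y : 'rV[R]_n) : u x + dot (grad u x) (y - x) <= u y.
Proof.
rewrite -lerBrDl; apply: (is_derive_le (is_derive_grad x (y - x) uC1)) => h h0 h1.
by rewrite lerBlDl; exact: convex_function_le (ltW h0) h1.
Qed.

Lemma grad_mono (x y : 'rV[R]_n) : 0 <= dot (grad u y - grad u x) (y - x).
Proof.
have := lerD (grad_le x y) (grad_le y x).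
rewrite -[x - y]opprB dotNr dotBl; lra.
Qed.

(** A supporting plane bounds the directional derivatives along both [v] and [- v] from below, which
    forces equality. *)
Lemma subgrad_unique (y q : 'rV[R]_n) :
  (forall z, u y + dot q (z - y) <= u z) -> grad u y = q.
Proof.
move=> uq.
have ge v : dot q v <= dot (grad u y) v.
  apply: (is_derive_ge (is_derive_grad y v uC1)) => h h0.
  by have := uq (y + h *: v); rewrite lerBrDl -dotZr addrAC subrr add0r.
apply/rowP => i; apply/eqP; rewrite eq_le -!dot_delta ge andbT.
by have := ge (- delta_mx 0 i); rewrite !dotNr lerN2.
Qed.

End Convex.

(** * The Hessian as second derivative along lines *)

Section SecondOrder.
Variables (R : realType) (n : nat) (u : 'rV[R]_n -> R).
Hypothesis uC2 : class_C 2 u.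

Lemma class_C2_C1 : class_C 1 u.
Proof.
have [uc uC] := uC2; split => // i; have [ud [pc _]] := uC i; by split.
Qed.

Lemma is_derive_dot_grad (x v : 'rV[R]_n) :
  is_derive x v (fun y => dot (grad u y) v) (dot v (v *m hessian u x)).
Proof.
pose F (i : 'I_n) := v 0 i *: partial i u.
have -> : (fun y => dot (grad u y) v) = \sum_(i < n) F i.
  apply/funext => y; rewrite fct_sumE; apply: eq_bigr => i _.
  by rewrite mxE mulrC.
have Fd i : is_derive x v (F i) (v 0 i *: dot (grad (partial i u) x) v).
  by apply: is_deriveZ; apply: is_derive_grad; case: uC2 => _ /(_ i) [].
apply: is_derive_eq (is_derive_sum Fd) _.
apply: eq_bigr => i _; rewrite mxE; congr (_ * _).
by apply: eq_bigr => j _; rewrite !mxE mulrC.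
Qed.

Lemma det_hessian_local_min (p z : 'rV[R]_n) (e : R) : 0 < e ->
  (\forall y \near z, u z - dot p z - e * dot z z <= u y - dot p y - e * dot y y) ->
  \det (hessian u z) != 0.
Proof.
move=> e0 zmin; apply/eqP => /eqP/det0P[v0 v0N0 v0H].
(* In a kernel direction v of the Hessian, chosen with D(u - p - e |.|^2)(z) v <= 0,
   u grows by less than e s^2 |v|^2 beyond first order. *)
pose l := grad u z - p - (2 * e) *: z.
have [v [vN0 vH lv]] : exists v, [/\ v != 0, v *m hessian u z = 0 & dot l v <= 0].
  have [lv|/ltW lv] := leP (dot l v0) 0; first by exists v0.
  by exists (- v0); rewrite oppr_eq0 mulNmx v0H oppr0 dotNr oppr_le0.
have vv := dotxx_gt0 vN0.
have uC1 := class_C2_C1.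
(* [D] is the slope of [u] along the line through [z]; its derivative at 0 is the Hessian form at
   [v], which vanishes. *)
pose D s := dot (grad u (z + s *: v)) v.
have : h^-1 * (D h - D 0) @[h --> 0^'+] --> (0 : R).
  have := is_derive_cvg_right (is_derive_dot_grad z v).
  by rewrite vH dot0r /D scale0r addr0.
move=> /cvgr_lt /(_ (e * dot v v)).
rewrite mulr_gt0// => /(_ isT); rewrite near_withinE => /nbhs_normP[r /= r0 Dr].
have : z + h *: v @[h --> (0 : R)] --> z.
  rewrite -{2}[z]addr0 -(scale0r v).
  by apply: cvgD; [exact: cvg_cst|apply: cvgZr_tmp].
move=> /(_ _ zmin) /nbhs_normP[r' /= r'0 zr].
pose s := Num.min r r' / 2.
have [s0 sr sr'] : [/\ 0 < s, s < r & s < r'].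
  rewrite /s; split; first by rewrite divr_gt0// lt_min r0.
  - by rewrite ltr_pdivrMr// gt_min; apply/orP; left; lra.
  - by rewrite ltr_pdivrMr// gt_min; apply/orP; right; lra.
have [t] : exists2 t, t \in `]0, s[ & u (z + s *: v) - u (z + 0 *: v) = D t * (s - 0).
  apply: (@MVT _ (fun s => u (z + s *: v))) => //.
    move=> x _; apply: is_derive_line; exact: is_derive_grad.
  apply: continuous_subspaceT => x; apply: derivable_line_continuous.
  exact: (@ex_derive _ _ _ _ _ _ _ (is_derive_grad _ _ uC1)).
rewrite in_itv/= scale0r addr0 subr0 => /andP[t0 ts] ut.
have := Dr t; rewrite /ball_/= sub0r normrN gtr0_norm// (lt_trans ts sr) => /(_ isT t0).
rewrite ltr_pdivrMl// => Dt.
have := zr s; rewrite /ball_/= sub0r normrN gtr0_norm// => /(_ sr').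
rewrite !dotDr !dotDl !dotZr !dotZl -/(dot _ _) (dotC v z).
have -> : u (z + s *: v) = u z + D t * s by rewrite -ut addrCA subrr addr0.
move: lv; rewrite /l !dotBl dotZl -[X in dot (grad u X)]addr0.
rewrite -[X in dot (grad u (z + X))](scale0r v) -/(D 0).
move: Dt; set A := D t; set B := D 0; set c := dot v v in vv *.
set zz := dot z z; set zv := dot z v; set pz := dot p z; set pv := dot p v.
move=> h1 h2 h3.
(* Minimality at [z] bounds the mean slope [A] from below. With [B <= pv + 2 * e * zv] this gives
   [A - B >= s * e * c], against [A - B < t * e * c] and [t < s]. *)
have h4 : s * (pv + 2 * e * zv + s * e * c) <= s * A by nra.
rewrite ler_pM2l// in h4.
have : t * (e * c) < s * (e * c) by rewrite ltr_pM2r// mulr_gt0.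
by lra.
Qed.

(** The gradient of a convex function is monotone, so [partial i u] is nondecreasing along
    coordinate [i]. *)
Lemma partial_diag_ge0 (x : 'rV[R]_n) (i : 'I_n) :
  convex_function [set: convex_lmodType 'rV[R]_n] u -> 0 <= hessian u x i i.
Proof.
move=> ucvx; rewrite mxE.
have [_ /(_ i) [_ piC]] := uC2.
have [_ /(_ i) [pd _]] := piC.
apply: (is_derive_ge (derivableP (pd x))) => h h0.
have := grad_mono ucvx class_C2_C1 x (x + h *: delta_mx 0 i).
by rewrite mulr0 addrAC subrr add0r dotZr dot_delta pmulr_rge0// !mxE.
Qed.

End SecondOrder.

(** * Compactness of balls and spheres for the sup norm *)

Section Compact.
Variables (R : realType) (n : nat).

Lemma norm_le_compact (r : R) : compact [set x : 'rV[R]_n | `|x| <= r].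
Proof.
apply: bounded_closed_compact.
  exists r; split; first exact: num_real.
  by move=> M rM x /= xr; rewrite (le_trans xr)// ltW.
by apply: (preimage_closed (f := fun x : 'rV[R]_n => `|x|)) (@closed_le _ r) => x _;
  exact: norm_continuous.
Qed.

Lemma norm_eq_compact (r : R) : compact [set x : 'rV[R]_n | `|x| = r].
Proof.
apply: subclosed_compact (@norm_le_compact r) _; last by move=> x /= ->.
by apply: (preimage_closed (f := fun x : 'rV[R]_n => `|x|)) (@closed_eq _ r) => x _;
  exact: norm_continuous.
Qed.

End Compact.

(** * A direction along which the gradient is constant *)

Section Flat.
Variables (R : realType) (n : nat) (u : 'rV[R]_n -> R).
Hypothesis uC2 : class_C 2 u.
Hypothesis ucvx : convex_function [set: convex_lmodType 'rV[R]_n] u.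
Hypothesis udet : forall x : 'rV[R]_n, \det (hessian u x) = 0.

Let uC1 : class_C 1 u := class_C2_C1 uC2.

Let u_continuous : continuous u. Proof. by case: uC2. Qed.

Let tilt_continuous (p : 'rV[R]_n) : continuous (fun x => u x - dot p x).
Proof.
by move=> x; apply: continuousB; [exact: u_continuous|exact: dot_continuous].
Qed.

Lemma sphere_point_le (p : 'rV[R]_n) (r : R) : 0 < r ->
  exists2 x, `|x| = r & u x - dot p x <= u 0.
Proof.
move=> r0; apply: contrapT => nx.
have gS x : `|x| = r -> u 0 < u x - dot p x.
  by move=> xr; rewrite ltNge; apply/negP => ux; apply: nx; exists x.
(* An empty matrix has determinant 1, so [udet] rules out [n = 0]; a nonzero vector shows that the
   sphere is nonempty. *)
have [v vN0 _] : exists2 v : 'rV[R]_n, v != 0 & v *m hessian u 0 = 0.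
  by apply/det0P; rewrite udet.
have Sn0 : [set x : 'rV[R]_n | `|x| = r] !=set0.
  exists ((r / `|v|) *: v) => /=.
  by rewrite normrZ normrM normfV normr_id divfK ?normr_eq0// gtr0_norm.
have [c cS cmin] := EVT_min_rV Sn0 (@norm_eq_compact _ _ r)
  (continuous_subspaceT (@tilt_continuous p)).
rewrite inE/= in cS.
(* [b] exceeds [dot x x] on the sphere, so subtracting [e * dot x x] uses up less than the gap
   between [u 0] and the minimum there. The minimizer over the ball is therefore interior. *)
pose b := n%:R * r ^+ 2 + 1.
have b0 : 0 < b by rewrite ltr_wpDl// mulr_ge0// sqr_ge0.
pose e := (u c - dot p c - u 0) / b.
have e0 : 0 < e by rewrite divr_gt0// subr_gt0 gS.
have eb : e * b = u c - dot p c - u 0 by rewrite /e divfK// gt_eqF.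
have hc : continuous (fun x => u x - dot p x - e * dot x x).
  move=> x; apply: (@continuousB _ _ _ (fun x => u x - dot p x)).
    exact: tilt_continuous.
  apply: continuousM; first exact: cst_continuous.
  move: x; apply: (@continuous_big _ _ +%R 0 xpredT) => [|i _ x].
    exact: add_continuous.
  by apply: continuousM; exact: coord_continuous.
have Kn0 : [set x : 'rV[R]_n | `|x| <= r] !=set0.
  by exists 0; rewrite /= normr0 ltW.
have [z zK zmin] := EVT_min_rV Kn0 (@norm_le_compact _ _ r) (continuous_subspaceT hc).
rewrite inE/= in zK.
have zr : `|z| < r.
  rewrite lt_neqAle zK andbT; apply/eqP => zr.
  have := zmin 0; rewrite !inE/= normr0 (ltW r0) !dot0r mulr0 !subr0 => /(_ isT).
  apply/negP; rewrite -ltNge.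
  have := cmin z; rewrite inE/= => /(_ zr) cz.
  have := dotxx_le_norm z; rewrite zr => zz.
  have : e * dot z z < e * b.
    by rewrite ltr_pM2l// (le_lt_trans zz)// ltrDl.
  by rewrite eb; lra.
have /eqP := udet z; apply/negP; apply: (det_hessian_local_min uC2 (p := p) e0).
have : \forall y \near z, `|y| < r.
  exact: (@cvgr_lt _ _ _ (nbhs_filter z) (fun y => `|y|) _ (@norm_continuous _ _ z)).
by apply: filterS => y yr; apply: zmin; rewrite inE/= ltW.
Qed.

(** Take low points on the spheres of radius [N.+1]. By convexity the bound holds on the segments
    from 0 to them, and their directions accumulate at some [v] by compactness. *)
Lemma exists_ray (p : 'rV[R]_n) :
  exists2 v, v != 0 & forall t, 0 <= t -> u (t *: v) - t * dot p v <= u 0.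
Proof.
have /choice[x xP] (N : nat) :
    exists x : 'rV[R]_n, `|x| = N.+1%:R /\ u x - dot p x <= u 0.
  by have [//|x] := @sphere_point_le p N.+1%:R; exists x.
pose w N := N.+1%:R^-1 *: x N.
have wS N : `|w N| = 1.
  by rewrite normrZ (xP N).1 normfV normr_nat mulVf.
have wt t N : 0 <= t -> t <= N.+1%:R -> u (t *: w N) - dot p (t *: w N) <= u 0.
  move=> t0 tN; have [_ xu] := xP N.
  have h0 : 0 <= t / N.+1%:R by rewrite divr_ge0.
  have h1 : t / N.+1%:R <= 1 by rewrite ler_pdivrMr// mul1r.
  have := convex_function_le ucvx 0 (x N) h0 h1.
  rewrite subr0 add0r /w scalerA dotZr => ux.
  have := ler_wpM2l h0 xu; rewrite mulrBr; move: ux; set h := t / _; lra.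
have wF : (w @ \oo) [set x | `|x| = 1] by apply: (@filterE _ \oo) => N /=.
have [v []] := @norm_eq_compact R n 1 (w @ \oo) _ wF.
move=> /= v1; rewrite clusterE => wv.
exists v; first by rewrite -normr_eq0 v1 oner_neq0.
move=> t t0.
(* For fixed [t] the bound is a closed condition on the direction, and [w N] satisfies it once
   [N.+1] is at least [t]. *)
pose A := [set y : 'rV[R]_n | u (t *: y) - dot p (t *: y) <= u 0].
have Acl : closed A.
  apply: (preimage_closed (f := fun y : 'rV[R]_n => u (t *: y) - dot p (t *: y)))
    (@closed_le _ (u 0)).
  move=> y _; apply: (@continuous_comp _ _ _ (fun y : 'rV[R]_n => t *: y)
    (fun y => u y - dot p y)).
    exact: scaler_continuous.
  exact: tilt_continuous.
have : A v.
  rewrite (closure_id A).1//; apply: wv.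
  have := @nbhs_infty_ger R t; apply: filterS => N tN /=.
  by apply: wt => //; rewrite (le_trans tN)// ler_nat.
by rewrite /A/= dotZr.
Qed.

Lemma exists_finite_flat (s : seq 'rV[R]_n) :
  exists2 v, v != 0 &
    forall x, x \in s -> dot (grad u x) v = dot (grad u 0) v.
Proof.
(* Including 0 makes the list nonempty and puts the reference gradient into the average. *)
pose s' := 0 :: s; pose m : R := (size s')%:R.
pose p := m^-1 *: \sum_(x <- s') grad u x.
have [v vN0 vp] := exists_ray p.
have le x : dot (grad u x) v <= dot p v.
  rewrite leNgt; apply/negP => lt.
  pose d := dot (grad u x) v - dot p v.
  have d0 : 0 < d by rewrite subr_gt0.
  (* By the gradient inequality at [x], [u - p] at [t *: v] exceeds [u 0] as soon as [t * d > C];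
     [t] is chosen to achieve this. *)
  pose C := u 0 - u x + dot (grad u x) x.
  pose t := (`|C| + 1) / d.
  have t0 : 0 <= t by rewrite divr_ge0// ltW// ltr_wpDl.
  have td : t * d = `|C| + 1 by rewrite /t divfK// gt_eqF.
  have := grad_le ucvx uC1 x (t *: v); rewrite dotBr dotZr.
  have := vp _ t0; have := ler_norm C; move: td; rewrite /d /C; lra.
(* The terms are nonnegative by [le] and sum to 0 because [p] is the average, so each vanishes. *)
have : \sum_(x <- s') (dot p v - dot (grad u x) v) == 0.
  rewrite sumrB /p dotZl big_const_seq count_predT iter_addr_0 -mulr_natl.
  rewrite -/m mulrA mulfV ?mul1r ?pnatr_eq0//.
  by rewrite dot_suml subrr.
rewrite psumr_eq0 => [/allP/= H|x _]; last by rewrite subr_ge0.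
have eq x : x \in s' -> dot (grad u x) v = dot p v.
  by move=> /H /=; rewrite subr_eq0 => /eqP.
by exists v => // x xs; rewrite !eq ?inE ?eqxx ?xs ?orbT.
Qed.

Lemma exists_flat :
  exists2 v, v != 0 & forall x, dot (grad u x) v = dot (grad u 0) v.
Proof.
pose W (s : seq 'rV[R]_n) := <<[seq grad u x - grad u 0 | x <- s]>>%VS.
pose P k := `[< exists s, \dim (W s) = k >].
have exP : exists k, P k by exists (\dim (W [::])); apply/asboolP; exists [::].
have ubP k : P k -> (k <= \dim {: 'rV[R]_n})%N.
  by move=> /asboolP[s <-]; exact: dimvS (subvf _).
have [k /asboolP[s sk] kmax] := ex_maxnP exP ubP.
have [v vN0 vs] := exists_finite_flat s.
exists v => // x.
(* By maximality, one more gradient difference cannot enlarge the span, so every difference is a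
   combination of those already orthogonal to [v]. *)
have Wx : W s = W (x :: s).
  apply/eqP; rewrite eqEdim sk kmax ?andbT; last by apply/asboolP; exists (x :: s).
  by rewrite /W /= span_cons addvSr.
have : grad u x - grad u 0 \in W s.
  by rewrite Wx; apply: memv_span; rewrite /= inE eqxx.
rewrite /W -[map _ _]/(tval (in_tuple _)) => /coord_span xs.
apply/eqP; rewrite -subr_eq0 -dotBl xs dotC.
elim/big_ind : _ => [|a b|i _]; first by rewrite dot0r.
  by rewrite dotDr => /eqP-> /eqP->; rewrite addr0.
rewrite dotZr; set y := _`_i; have : y \in [seq grad u x - grad u 0 | x <- s].
  by apply: mem_nth; rewrite -[X in (_ < X)%N](size_tuple (in_tuple _)).
by move=> /mapP[z /vs zs ->]; rewrite dotC dotBl zs subrr mulr0.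
Qed.

End Flat.

(** * Translation invariance, decay at infinity, and affinity *)

Section Liouville.
Variables (R : realType) (n : nat) (u : 'rV[R]_n -> R).

(** The difference quotients at [x + w] and at [x] are the same function of [h], hence so are their
    limits. *)
Lemma partial_translate (f : 'rV[R]_n -> R) (w : 'rV[R]_n) (c : R) (i : 'I_n) :
  (forall x, f (x + w) = f x + c) ->
  forall x, partial i f (x + w) = partial i f x.
Proof.
move=> fw x; rewrite /partial /derive; set q := fun h : R => _; set q' := fun h : R => _.
suff -> : q = q' by [].
apply/funext => h; rewrite /q /q' /=.
by rewrite addrA !fw opprD addrACA subrr addr0.
Qed.

Lemma laplacian_translate (w : 'rV[R]_n) (c : R) :
  (forall x, u (x + w) = u x + c) ->
  forall x, laplacian u (x + w) = laplacian u x.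
Proof.
move=> uw x; apply: eq_bigr => i _; rewrite !mxE.
apply: (@partial_translate _ _ 0) => y.
by rewrite addr0; exact: partial_translate uw _.
Qed.

Lemma norm_coord_le_euclidean (x : 'rV[R]_n) (i : 'I_n) :
  `|x 0 i| <= euclidean_norm x.
Proof.
rewrite -sqrtr_sqr ler_wsqrtr// (bigD1 i)//= lerDl.
by apply: sumr_ge0 => j _; rewrite sqr_ge0.
Qed.

Lemma laplacian_eq0 (v : 'rV[R]_n) :
  v != 0 ->
  (forall t x, laplacian u (x + t *: v) = laplacian u x) ->
  laplacian u x @[x --> at_infinity (n := n)] --> (0 : R) ->
  forall x, laplacian u x = 0.
Proof.
move=> vN0 uv ulap x.
have [i viN0] : exists i, v 0 i != 0.
  apply: contrapT => vi; move/eqP: vN0; apply; apply/rowP => i; rewrite mxE.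
  by apply/eqP/negPn/negP => vi0; apply: vi; exists i.
apply: contrapT => /eqP lN0.
rewrite -normr_gt0 in lN0.
have [M _ MP] := ulap _ (nbhsx_ballx (0 : R) _ lN0).
(* This makes coordinate [i] of [x + t *: v] equal to the absolute value of [M] plus 1, so the point
   lies where the Laplacian is smaller in size than its value at [x]. *)
pose t := (`|M| + 1 - x 0 i) / v 0 i.
suff /MP : M < euclidean_norm (x + t *: v).
  by rewrite /= uv /ball/= sub0r normrN ltxx.
apply: lt_le_trans (norm_coord_le_euclidean _ i).
rewrite !mxE divfK// addrCA subrr addr0 ger0_norm ?addr_ge0//.
by rewrite (le_lt_trans (ler_norm M))// ltrDl.
Qed.

Hypothesis uC2 : class_C 2 u.
Hypothesis ucvx : convex_function [set: convex_lmodType 'rV[R]_n] u.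

Let uC1 : class_C 1 u := class_C2_C1 uC2.

(** The gradient inequalities at the two ends of the segment bound the increment by [t * c] from
    both sides. *)
Lemma flat_translate (v : 'rV[R]_n) (c : R) :
  (forall x, dot (grad u x) v = c) ->
  forall t x, u (x + t *: v) = u x + t * c.
Proof.
move=> uv t x; apply/eqP; rewrite eq_le.
have := grad_le ucvx uC1 x (x + t *: v).
have := grad_le ucvx uC1 (x + t *: v) x.
rewrite opprD addNKr dotNr addrAC subrr add0r !dotZr !uv => h1 h2.
by apply/andP; split; lra.
Qed.

(** The diagonal Hessian entries are nonnegative with sum 0, so all vanish. Thus [u] is affine along
    each coordinate line, which makes the whole gradient constant there, hence everywhere. *)
Lemma laplacian0_affine : (forall x, laplacian u x = 0) -> affine_function u.
Proof.
move=> lap0.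
have diag0 x i : hessian u x i i = 0.
  move/eqP: (lap0 x); rewrite /laplacian /mxtrace psumr_eq0 => [/allP H|j _].
    by apply/eqP/(H i); exact: mem_index_enum.
  exact: partial_diag_ge0.
have partial_cst x i t : partial i u (x + t *: delta_mx 0 i) = partial i u x.
  have [_ /(_ i) [_ [_ /(_ i) [pd _]]]] := uC2.
  have [s _] := mvt_line t (fun s => pd (x + s *: delta_mx 0 i)).
  have := diag0 (x + s *: delta_mx 0 i) i; rewrite mxE {1}/partial => ->.
  by rewrite mulr0 => /eqP; rewrite subr_eq0 => /eqP.
have line x i t :
    u (x + t *: delta_mx 0 i) = u x + t * dot (grad u x) (delta_mx 0 i).
  have := grad_le ucvx uC1 x (x + t *: delta_mx 0 i).
  have := grad_le ucvx uC1 (x + t *: delta_mx 0 i) x.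
  rewrite opprD addNKr dotNr addrAC subrr add0r !dotZr !dot_delta !mxE.
  by rewrite partial_cst => h1 h2; apply/eqP; rewrite eq_le; apply/andP; split; lra.
(* The supporting plane of u at x touches u at x + t e_i. *)
have grad_line x i t : grad u (x + t *: delta_mx 0 i) = grad u x.
  apply: subgrad_unique => // z.
  rewrite line -dotZr -addrA -dotDr addrCA opprD [t *: _ + _]addrCA subrr addr0.
  exact: grad_le.
have grad_cst x : grad u x = grad u 0.
  (* Reach [x] from 0 by one coordinate move at a time. *)
  rewrite [x]row_sum_delta.
  elim/big_rec : _ => // i y _ <-.
  by rewrite addrC grad_line.
exists (grad u 0), (u 0) => x; rewrite -/(dot _ _).
have := grad_le ucvx uC1 0 x; have := grad_le ucvx uC1 x 0.
rewrite grad_cst subr0 sub0r dotNr => h1 h2.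
by apply/eqP; rewrite eq_le; apply/andP; split; lra.
Qed.

End Liouville.

Theorem theorem1p2 (R : realType) (n : nat) (u : 'rV[R]_n -> R)
    (uC2 : class_C 2 u)
    (ucvx : convex_function [set: convex_lmodType 'rV[R]_n] u)
    (udet : forall x : 'rV[R]_n, \det (hessian u x) = 0)
    (ulap : laplacian u x @[x --> at_infinity (n := n)] --> (0 : R)) :
  affine_function u.
Proof.
have [v vN0 uv] := exists_flat uC2 ucvx udet.
apply: laplacian0_affine => //; apply: laplacian_eq0 vN0 _ ulap => t.
by apply: laplacian_translate => x; exact: flat_translate.
Qed.
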